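(* Let $k\ge 3$ and let $p_1\ge p_2\ge\cdots\ge p_k\ge 1$ and $q_1\ge q_2\ge\cdots\ge q_k\ge 1$ be two different $k$-tuples of integers with $\sum_{i=1}^k p_i=\sum_{i=1}^k q_i$. Then the complete $k$-partite graphs $K_{p_1,\ldots,p_k}$ and $K_{q_1,\ldots,q_k}$ are not switching equivalent.
   Context: All graphs are finite and simple. For a partition $V(G)=U\cup W$ of the vertex set of a graph $G$, Seidel switching with respect to $U$ produces the graph on the same vertex set obtained by deleting all edges between $U$ and $W$ and adding an edge between $u\in U$ and $w\in W$ whenever $uw$ was not an edge of $G$ (edges inside $U$ and inside $W$ are unchanged). Two graphs are switching equivalent if one is obtained from the other by a Seidel switching. *)

(* Defs.v *)
From mathcomp Require Import all_boot.

Set Implicit Arguments.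
Unset Strict Implicit.
Unset Printing Implicit Defensive.

Record sgraph (T : finType) := SGraph {
  adj : rel T;
  adj_sym : symmetric adj;
  adj_irrefl : irreflexive adj
}.

Section Switching.
Variable T : finType.
Implicit Types (G : sgraph T) (U : {set T}).

(* The second class of the partition is W = ~: U; U or W may be empty. *)
Definition switch_rel G U : rel T :=
  fun x y => if (x \in U) == (y \in U) then adj G x y else ~~ adj G x y.

Lemma switch_sym G U : symmetric (switch_rel G U).
Proof. by move=> x y; rewrite /switch_rel eq_sym adj_sym. Qed.

Lemma switch_irrefl G U : irreflexive (switch_rel G U).
Proof. by move=> x; rewrite /switch_rel eqxx adj_irrefl. Qed.

Definition switch G U : sgraph T := SGraph (@switch_sym G U) (@switch_irrefl G U).

End Switching.

Definition graph_iso (T T' : finType) (G : sgraph T) (H : sgraph T') : Prop :=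
  exists2 f : T -> T', bijective f & forall x y, adj H (f x) (f y) = adj G x y.

(* Graphs are considered up to isomorphism, so that the notion makes sense
   for graphs with different vertex types. *)
Definition switching_equivalent (T T' : finType) (G : sgraph T) (H : sgraph T')
  : Prop := exists U : {set T}, graph_iso (switch G U) H.

Section CompleteMultipartite.
Variables (k : nat) (p : k.-tuple nat).

(* Vertex (i, a) is the a-th vertex of the i-th part, of size tnth p i. *)
Definition multipartite_vertex : finType := {i : 'I_k & 'I_(tnth p i)}.

Definition multipartite_rel : rel multipartite_vertex :=
  fun x y => tag x != tag y.

Lemma multipartite_sym : symmetric multipartite_rel.
Proof. by move=> x y; rewrite /multipartite_rel eq_sym. Qed.

Lemma multipartite_irrefl : irreflexive multipartite_rel.
Proof. by move=> x; rewrite /multipartite_rel eqxx. Qed.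

Definition complete_multipartite : sgraph multipartite_vertex :=
  SGraph multipartite_sym multipartite_irrefl.

End CompleteMultipartite.

(* Main.v *)
Require Import Defs.
From mathcomp Require Import all_boot all_fingroup.

(** In a complete multipartite graph non-adjacency is transitive.  If switching
    [K_p] with respect to [U] keeps this property, then three vertices in
    distinct parts lie on the same side of [U]: otherwise the one that is alone
    on its side becomes non-adjacent to the two others, which stay adjacent.
    As there are at least three parts, this forces [U] to be empty or full,
    so that switching changes nothing, and isomorphic complete multipartite
    graphs have the same part sizes up to order. *)

(** A multiset of naturals has only one listing sorted for [geq]. *)
Lemma sorted_tuple_perm_eq (k : nat) (p q : k.-tuple nat) (s : 'S_k) :
  (forall i j : 'I_k, i <= j -> tnth p j <= tnth p i) ->
  (forall i j : 'I_k, i <= j -> tnth q j <= tnth q i) ->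
  (forall i, tnth q (s i) = tnth p i) -> p = q.
Proof.
have sortP (t : k.-tuple nat) :
    (forall i j : 'I_k, i <= j -> tnth t j <= tnth t i) -> sorted geq t.
  move=> t_decr; apply/(sortedP 0) => i lt_i; rewrite size_tuple in lt_i.
  have := t_decr (Ordinal (ltnW lt_i)) (Ordinal lt_i) (leqnSn i).
  by rewrite !(tnth_nth 0).
move=> /sortP p_sorted /sortP q_sorted qE; apply: val_inj.
apply: (sorted_eq (leT := geq)) => //.
- by move=> a b c /= ba ac; apply: leq_trans ac ba.
- by move=> a b /=; rewrite andbC -eqn_leq => /eqP.
- by apply/tuple_permP; exists s; congr val; apply: eq_from_tnth => i;
    rewrite tnth_mktuple qE.
Qed.

Lemma switch_trivial (T : finType) (G : sgraph T) (U : {set T}) :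
  (forall x y, (x \in U) = (y \in U)) -> adj (switch G U) =2 adj G.
Proof. by move=> U_const x y; rewrite /= /switch_rel (U_const x y) eqxx. Qed.

(** Serves to pick a part different from one or two given ones. *)
Lemma exists_ord_notin (k : nat) (s : seq 'I_k) :
  size s < k -> exists i, i \notin s.
Proof.
move=> lt_sk; apply/existsP; apply: contraLR lt_sk.
rewrite negb_exists -leqNgt => /forallP s_full.
rewrite -[k in k <= _]card_ord; apply: leq_trans (card_size s).
by apply/subset_leq_card/subsetP => i _; have := s_full i; rewrite negbK.
Qed.

Section MultipartiteSwitching.
Variables (k : nat) (p : k.-tuple nat).
Hypothesis p_pos : forall i : 'I_k, 1 <= tnth p i.
Let V := multipartite_vertex p.

Definition part (i : 'I_k) : {set V} := [set x : V | tag x == i].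

(** Since [1 <= n] unfolds to [0 < n], this is the vertex of index 0 in part [i]. *)
Definition part_repr (i : 'I_k) : V := Tagged _ (Ordinal (p_pos i)).

Lemma card_part (i : 'I_k) : #|part i| = tnth p i.
Proof.
have Tagged_inj : injective (Tagged (fun j : 'I_k => 'I_(tnth p j)) (i := i)).
  by move=> a b /eqP; rewrite eq_Tagged => /eqP.
rewrite -[RHS]card_ord -(card_imset _ Tagged_inj); congr #|pred_of_set _|.
apply/setP => x; rewrite inE; apply/eqP/imsetP => [<-|[a _ ->] //].
by exists (tagged x) => //; case: x.
Qed.

Lemma switch_multipartite_trivial (U : {set V}) :
  3 <= k ->
  (forall y x z, ~~ adj (switch (complete_multipartite p) U) x y ->
     ~~ adj (switch (complete_multipartite p) U) y z ->
     ~~ adj (switch (complete_multipartite p) U) x z) ->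
  forall x y, (x \in U) = (y \in U).
Proof.
move=> k_ge3 nadj_trans.
have three (x y z : V) : tag x != tag y -> tag y != tag z -> tag x != tag z ->
    (x \in U) = (y \in U).
  move=> xy yz xz; have yx : tag y != tag x by rewrite eq_sym.
  (* If [U] separates [x] from [y], the vertex alone on its side is one of these two, wherever [z]
     lies; so only they are tried as middle vertex. *)
  have := nadj_trans y x z; have := nadj_trans x y z.
  rewrite /= /switch_rel /= /multipartite_rel xy yz xz yx.
  by case: (x \in U); case: (y \in U); case: (z \in U) => //= Hx Hy;
    do [have := Hx isT isT | have := Hy isT isT].
move=> x y; have [xy|xy] := eqVneq (tag x) (tag y).
  (* Two vertices of one part are compared through a vertex of part [i]; [j] supplies the third part
     that [three] requires. *)
  have [i] : exists i, i \notin [:: tag x] by apply: exists_ord_notin; apply: ltnW.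
  have [j] : exists j, j \notin [:: tag x; i] by apply: exists_ord_notin.
  rewrite !inE negb_or => /andP[jx ji] ix.
  rewrite (three x (part_repr i) (part_repr j)) /= 1?[_ == i]eq_sym 1?[_ == j]eq_sym //.
  by rewrite (three (part_repr i) y (part_repr j)) /= -?xy 1?[_ == j]eq_sym.
have [j] : exists j, j \notin [:: tag x; tag y] by apply: exists_ord_notin.
rewrite !inE negb_or => /andP[jx jy].
by apply: (three x y (part_repr j)); rewrite //= eq_sym.
Qed.

End MultipartiteSwitching.

(** Being in the same part means being non-adjacent, so an isomorphism induces an injection on part
    indices, which is a permutation by finiteness. *)
Lemma multipartite_iso_perm (k : nat) (p q : k.-tuple nat) :
  (forall i : 'I_k, 1 <= tnth p i) ->
  graph_iso (complete_multipartite p) (complete_multipartite q) ->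
  exists s : 'S_k, forall i, tnth q (s i) = tnth p i.
Proof.
move=> p_pos [f f_bij f_adj].
have f_tag x y : (tag (f x) == tag (f y)) = (tag x == tag y).
  by apply: negb_inj; apply: f_adj.
pose g i := tag (f (part_repr k p p_pos i)).
have g_inj : injective g by move=> i j /eqP; rewrite f_tag => /eqP.
exists (perm g_inj) => i; rewrite permE -!card_part.
(* The preimage under [f] of the part of index [g i] is exactly [part i]. *)
rewrite -(on_card_preimset (f := f)); last exact: onW_bij.
by congr #|pred_of_set _|; apply/setP => x; rewrite !inE f_tag.
Qed.

Theorem theorem3p4 (k : nat) (p q : k.-tuple nat)
  (hk : 3 <= k)
  (p_decr : forall i j : 'I_k, i <= j -> tnth p j <= tnth p i)
  (p_pos : forall i : 'I_k, 1 <= tnth p i)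
  (q_decr : forall i j : 'I_k, i <= j -> tnth q j <= tnth q i)
  (q_pos : forall i : 'I_k, 1 <= tnth q i)
  (p_neq_q : p <> q)
  (sum_eq : \sum_(i < k) tnth p i = \sum_(i < k) tnth q i) :
  ~ switching_equivalent (complete_multipartite p) (complete_multipartite q).
Proof.
move=> [U [f f_bij f_adj]]; apply: p_neq_q.
have U_const : forall x y, (x \in U) = (y \in U).
  apply: (switch_multipartite_trivial k p p_pos U hk) => y x z.
  (* Transported by [f], non-adjacency becomes equality of tags in the second graph, which is
     transitive. *)
  by rewrite -!f_adj /= /multipartite_rel !negbK => /eqP ->.
have [s sE] : exists s : 'S_k, forall i, tnth q (s i) = tnth p i.
  apply: multipartite_iso_perm => //; exists f => // x y.
  by rewrite f_adj switch_trivial.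
exact: sorted_tuple_perm_eq sE.
Qed.
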